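(* Let $m\ge 1$ and $\mathcal{X}=\{0,1\}^m$. Every function $\hat v:\mathcal{X}\to\mathbb{R}_{+}$ that is normalized (N) and monotone (M) can be represented exactly as a monotone-value neural network (MVNN) with cutoff $t=1$, and conversely; that is, with $\mathcal{V}_{\mathrm{mon}}$ the set of all normalized and monotone functions $\mathcal{X}\to\mathbb{R}_+$, $$\mathcal{V}_{\mathrm{mon}}=\left\{\mathcal{N}_{(W,b)}:\mathcal{X}\to\mathbb{R}_+ \;:\; W\ge 0,\ b\le 0\right\},$$ where the right-hand side ranges over all MVNNs, of any number of layers and any hidden-layer dimensions, with weights $W$ entrywise non-negative and biases $b$ entrywise non-positive.
   Context: $\mathbb{R}_+=[0,\infty)$. Elements of $\mathcal{X}=\{0,1\}^m$ are indicator vectors of bundles (subsets) of $\{1,\dots,m\}$. A function $\hat v:\mathcal{X}\to\mathbb{R}_+$ satisfies: (N) normalization if $\hat v((0,\dots,0))=0$; (M) monotonicity if $\hat v(x)\le \hat v(y)$ whenever $x\le y$ componentwise (i.e. the bundle of $x$ is a subset of the bundle of $y$). The bounded ReLU with cutoff $t>0$ is $\varphi_{0,t}(z)=\min(t,\max(0,z))$, applied componentwise to vectors; here $t=1$. An MVNN with $K\ge 1$ and layer dimensions $d^0=m,d^1,\dots,d^{K-1},d^K=1$ is the function $\mathcal{N}_{(W,b)}:\mathcal{X}\to\mathbb{R}_+$ given by $\mathcal{N}_{(W,b)}(x)=W^{K}z^{K-1}$, where $z^0=x$ and $z^k=\varphi_{0,t}(W^kz^{k-1}+b^k)$ for $k=1,\dots,K-1$,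 with $W^k\in\mathbb{R}^{d^k\times d^{k-1}}$ entrywise $\ge 0$ for $k=1,\dots,K$ and $b^k\in\mathbb{R}^{d^k}$ entrywise $\le 0$ for $k=1,\dots,K-1$ (there is no bias and no activation in the output layer). The parameters are $W=(W^k)_k$, $b=(b^k)_k$. *)

(* Defs.v *)
From mathcomp Require Import all_boot all_order all_algebra.
From mathcomp Require Import boolp classical_sets reals.

Set Implicit Arguments.
Unset Strict Implicit.
Unset Printing Implicit Defensive.

Import Order.TTheory GRing.Theory Num.Theory.

Local Open Scope classical_set_scope.
Local Open Scope ring_scope.

Definition bundle (m : nat) := {ffun 'I_m -> bool}.

Definition indicator (R : realType) (m : nat) (x : bundle m) : 'cV[R]_m :=
  \col_i (x i)%:R.

Definition normalized (R : realType) (m : nat) (v : bundle m -> R) : Prop :=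
  v [ffun=> false] = 0.

Definition monotone (R : realType) (m : nat) (v : bundle m -> R) : Prop :=
  forall x y : bundle m, (forall i, (x i <= y i)%N) -> v x <= v y.

(* A function into [0, +oo) is a function into R with nonnegative values. *)
Definition Vmon (R : realType) (m : nat) : set (bundle m -> R) :=
  [set v | [/\ forall x, 0 <= v x, normalized v & monotone v]].

Definition brelu (R : realType) (t z : R) : R := Num.min t (Num.max 0 z).

(* [h k] is the dimension of the hidden layer k+1; layer 0 is the input. *)
Definition layer_dim (m : nat) (h : nat -> nat) (k : nat) : nat :=
  if k is k'.+1 then h k' else m.

(* A network with K = nhidden + 1 layers. [weight k] and [bias k] are the
   parameters W^(k+1) and b^(k+1) of the hidden layer k+1, and [weight_out] is
   W^K. Layers are indexed by all of nat to avoid casts between dimensions: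
   the parameters of index k >= nhidden are never used. *)
Record network (R : realType) (m : nat) := Network {
  nhidden : nat;
  hidden_dim : nat -> nat;
  hidden_dim_gt0 : forall k, (0 < hidden_dim k)%N;
  weight : forall k,
    'M[R]_(layer_dim m hidden_dim k.+1, layer_dim m hidden_dim k);
  bias : forall k, 'cV[R]_(layer_dim m hidden_dim k.+1);
  weight_out : 'rV[R]_(layer_dim m hidden_dim nhidden)
}.

Fixpoint layer_value (R : realType) (m : nat) (t : R) (N : network R m)
    (x : bundle m) (k : nat) : 'cV[R]_(layer_dim m (hidden_dim N) k) :=
  match k with
  | 0 => indicator R x
  | k'.+1 => map_mx (brelu t) (weight N k' *m layer_value t N x k' + bias N k')
  end.

Definition network_fun (R : realType) (m : nat) (t : R) (N : network R m)
    (x : bundle m) : R :=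
  (weight_out N *m layer_value t N x (nhidden N)) 0 0.

Definition nonneg_weights (R : realType) (m : nat) (N : network R m) : Prop :=
  (forall k, (k < nhidden N)%N -> weight N k \is a mxOver Num.nneg) /\
  weight_out N \is a mxOver Num.nneg.

Definition nonpos_biases (R : realType) (m : nat) (N : network R m) : Prop :=
  forall k, (k < nhidden N)%N -> bias N k \is a mxOver Num.npos.

Definition MVNN (R : realType) (m : nat) (t : R) : set (bundle m -> R) :=
  [set network_fun t N | N in
     [set N : network R m | nonneg_weights N /\ nonpos_biases N]].

Arguments Vmon R m : clear implicits.
Arguments MVNN R m t : clear implicits.

(* Main.v *)
(** A normalized monotone [v] is a nonnegative combination of the indicators of
    its upper level sets [c <= v x] with [c > 0].  Such a set is the disjunction,
    over the bundles [y] with [c <= v y], of the conjunctions [y <= x]; both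
    connectives are bounded-ReLU units with nonnegative weights, and the
    conjunction over [y] has bias [1 - #|y|], which is nonpositive because
    [v y > 0] forces [y] to be nonempty.  Two hidden layers thus suffice.
    Conversely, each layer is monotone and maps [0] to [0]. *)

Require Import Defs.
From mathcomp Require Import all_boot all_order all_algebra.
From mathcomp Require Import boolp classical_sets reals.

Set Implicit Arguments.
Unset Strict Implicit.
Unset Printing Implicit Defensive.

Import Order.TTheory GRing.Theory Num.Theory.

Local Open Scope classical_set_scope.
Local Open Scope ring_scope.

Lemma brelu_mono (R : realType) (t : R) : {homo brelu t : x y / x <= y}.
Proof.
move=> x y xy; rewrite /brelu le_min ge_min lexx /= ge_min.
by rewrite ge_max !le_max lexx xy /= !orbT.
Qed.

Lemma brelu_npos (R : realType) (t z : R) : 0 <= t -> z <= 0 -> brelu t z = 0.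
Proof. by move=> t0 z0; rewrite /brelu max_l // min_r. Qed.

(** A difference of naturals is either at most 0 or at least 1, so cutting off at 0 and 1 leaves a
    Boolean: on integers the unit is a threshold gate. *)
Lemma brelu1_natB (R : realType) (a b : nat) :
  brelu 1 (a%:R - b%:R : R) = (b < a)%:R.
Proof.
case: ltnP => [ba|ab]; last by rewrite brelu_npos // subr_le0 ler_nat.
rewrite /brelu -natrB ?(ltnW ba)// max_r ?ler0n// min_l//.
by rewrite ler1n subn_gt0.
Qed.

Lemma layer_value_mono (R : realType) (m : nat) (t : R) (N : network R m)
    (x y : bundle m) (k : nat) :
    nonneg_weights N -> (forall i, (x i <= y i)%N) -> (k <= nhidden N)%N ->
  forall i, layer_value t N x k i 0 <= layer_value t N y k i 0.
Proof.
move=> [W0 _] xy; elim: k => [_ i|k IH kN i] /=; first by rewrite !mxE ler_nat.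
rewrite !mxE; apply/brelu_mono/lerD => //; apply: ler_sum => j _.
by apply: ler_wpM2l; [have /mxOverP := W0 k kN; apply | apply: IH; apply: ltnW].
Qed.

Lemma layer_value0 (R : realType) (m : nat) (t : R) (N : network R m)
    (k : nat) :
    0 <= t -> nonpos_biases N -> (k <= nhidden N)%N ->
  layer_value t N [ffun=> false] k = 0.
Proof.
move=> t0 b0; elim: k => [_|k IH kN] /=.
  by apply/matrixP => i j; rewrite !mxE ffunE.
rewrite IH ?(ltnW kN)// mulmx0 add0r; apply/matrixP => i j; rewrite !mxE.
by apply: brelu_npos => //; have /mxOverP := b0 k kN; apply.
Qed.

Lemma MVNN_sub_Vmon (R : realType) (m : nat) (t : R) :
  0 <= t -> MVNN R m t `<=` Vmon R m.
Proof.
move=> t0 _ [N [W0 b0] <-].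
have norm : normalized (network_fun t N).
  by rewrite /normalized /network_fun layer_value0// mulmx0 mxE.
have mono : monotone (network_fun t N).
  move=> x y xy; rewrite /network_fun !mxE; apply: ler_sum => j _.
  apply: ler_wpM2l; first by have [_ /mxOverP] := W0; apply.
  exact: layer_value_mono.
(* Nonnegativity follows from the other two properties, the empty bundle being below every [x]. *)
split=> // x; rewrite -norm; apply: mono => i; by rewrite ffunE.
Qed.

(** Packs matrices of plain dimensions into the dependently typed [network]; the layers beyond the
    second are filler. *)
Lemma two_hidden_layers_MVNN (R : realType) (m n1 n2 : nat) (t : R)
    (W1 : 'M[R]_(n1, m)) (b1 : 'cV[R]_n1) (W2 : 'M[R]_(n2, n1))
    (b2 : 'cV[R]_n2) (W3 : 'rV[R]_n2) :
    (0 < n1)%N -> (0 < n2)%N ->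
    W1 \is a mxOver Num.nneg -> b1 \is a mxOver Num.npos ->
    W2 \is a mxOver Num.nneg -> b2 \is a mxOver Num.npos ->
    W3 \is a mxOver Num.nneg ->
  MVNN R m t (fun x => (W3 *m map_mx (brelu t)
    (W2 *m map_mx (brelu t) (W1 *m indicator R x + b1) + b2)) 0 0).
Proof.
move=> n1_gt0 n2_gt0 W1_ge0 b1_le0 W2_ge0 b2_le0 W3_ge0.
pose h k := if k is 0 then n1 else n2.
have h_gt0 k : (0 < h k)%N by case: k.
pose W k : 'M[R]_(layer_dim m h k.+1, layer_dim m h k) :=
  match k with 0 => W1 | 1 => W2 | _ => 0 end.
pose b k : 'cV[R]_(layer_dim m h k.+1) :=
  match k with 0 => b1 | 1 => b2 | _ => 0 end.
exists (@Network R m 2 h h_gt0 W b W3) => //.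
by split; [split=> //|]; case=> [|[|]].
Qed.

(** Telescoping over the sorted distinct values of [f]: the [c j] are these values and the [a j]
    their successive gaps. The bound [a j <= c j] forces weight 0 on a threshold 0. *)
Lemma staircase_sum (R : realType) (T : finType) (f : T -> R) :
    (0 < #|T|)%N -> (forall x, 0 <= f x) ->
  exists n (c a : 'I_n -> R), [/\ (0 < n)%N, forall j, 0 <= a j <= c j &
    forall x, f x = \sum_(j | c j <= f x) a j].
Proof.
move=> /card_gt0P[x0 _] f_ge0.
pose s := sort <=%R (undup (codom f)).
have s_mem z : (z \in s) = (z \in codom f) by rewrite mem_sort mem_undup.
have s_lt : sorted <%R s by rewrite sort_lt_sorted undup_uniq.
have s_ge0 j : 0 <= s`_j.
  have [js|sj] := ltnP j (size s); last by rewrite nth_default.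
  by have /codomP[x ->] : s`_j \in codom f by rewrite -s_mem mem_nth.
(* Prepending 0 shifts the indices, so the subtracted term is the previous value, or 0 when [j] is
   0. *)
exists (size s), (fun j => s`_j), (fun j => s`_j - (0 :: s)`_j); split.
- by have := codom_f f x0; rewrite -s_mem; case: (s).
- move=> [[|j] js] /=; first by rewrite subr0 s_ge0 lexx.
  rewrite subr_ge0 gerBl s_ge0 andbT.
  by rewrite (lt_sorted_leq_nth 0 s_lt) ?inE// ltnW.
- move=> x; have := codom_f f x; rewrite -s_mem => /(nthP 0)[i si <-].
  transitivity (\sum_(0 <= j < i.+1) ((0 :: s)`_j.+1 - (0 :: s)`_j)).
    by rewrite telescope_sumr//= subr0.
  rewrite big_mkord (big_ord_widen (size s)
    (fun j => (0 :: s)`_j.+1 - (0 :: s)`_j) si).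
  (* As [s] is strictly increasing, the thresholds not exceeding the value of index [i] are those
     with [j <= i]. *)
  apply: eq_bigl => j.
  by rewrite (lt_sorted_leq_nth 0 s_lt) ?inE.
Qed.

(* For the empty [y] the truncated predecessor gives bias 0, so that the unit is
   constantly 0 instead of constantly 1. *)
Lemma conjunction_unit (m : nat) (x y : bundle m) :
  ((\sum_i y i).-1 < \sum_i y i * x i)%N =
  (y != [ffun=> false]) && [forall i, (y i <= x i)%N].
Proof.
(* Carrying the equality case through the sum shows that the two sums agree exactly when [y] is
   below [x]. *)
have le_sum i : true -> (y i * x i <= y i ?= iff (y i <= x i))%N.
  by move=> _; split; case: (y i); case: (x i).
have [le_yx eq_yx] := leqif_sum le_sum.
have -> : (y != [ffun=> false]) = (0 < \sum_i y i)%N.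
  rewrite lt0n sum_nat_eq0; congr (~~ _); apply/eqP/forallP => [-> i|y0].
    by rewrite ffunE.
  by apply/ffunP => i; rewrite ffunE; have := y0 i; case: (y i).
rewrite -eq_yx; case: (\sum_i y i)%N le_yx => [|k] /=.
  by rewrite leqn0 => /eqP->.
by move=> le_yx; rewrite eqn_leq le_yx.
Qed.

Lemma Vmon_sub_MVNN (R : realType) (m : nat) : Vmon R m `<=` MVNN R m 1.
Proof.
move=> v [v_ge0 v0 v_mono].
have card_gt0 : (0 < #|bundle m|)%N by apply/card_gt0P; exists [ffun=> false].
have [n [c [a [n_gt0 a_bounds va]]]] := staircase_sum card_gt0 v_ge0.
have a_ge0 j : 0 <= a j by have /andP[] := a_bounds j.
have a_le j : a j <= c j by have /andP[] := a_bounds j.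
(* The first layer has one conjunction unit per bundle, the second one disjunction unit per
   threshold. *)
pose y (k : 'I_#|bundle m|) : bundle m := enum_val k.
pose W1 : 'M[R]_(_, m) := \matrix_(k, i) (y k i)%:R.
pose b1 : 'cV[R]_#|bundle m| := \col_k - ((\sum_i y k i).-1)%:R.
pose W2 : 'M[R]_(n, _) := \matrix_(j, k) (c j <= v (y k))%R%:R.
pose W3 : 'rV[R]_n := \row_j a j.
suff -> : v = fun x => (W3 *m map_mx (brelu 1)
    (W2 *m map_mx (brelu 1) (W1 *m indicator R x + b1) + 0)) 0 0.
  apply: two_hidden_layers_MVNN => //; apply/mxOverP => i j;
    rewrite !mxE ?nnegrE ?nposrE ?oppr_le0 ?ler0n ?a_ge0 ?lexx //.
apply/funext => x; rewrite [LHS]va big_mkcond [RHS]mxE.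
apply: eq_bigr => j _.
(* If [c j <= 0], the level set contains the empty bundle, where the unit outputs 0; the weight
   [a j] then vanishes. *)
have [cj0|cj_gt0] := leP (c j) 0.
  have aj : a j = 0 by apply/le_anti; rewrite a_ge0 (le_trans (a_le j)).
  by rewrite !mxE aj mul0r if_same.
have layer1 k : map_mx (brelu 1) (W1 *m indicator R x + b1) k 0 =
    ((y k != [ffun=> false]) && [forall i, (y k i <= x i)%N])%:R.
  rewrite -conjunction_unit -brelu1_natB !mxE natr_sum.
  congr (brelu _ (_ - _)); apply: eq_bigr => i _.
  by rewrite !mxE natrM.
rewrite [W3 _ _]mxE [X in _ * X]mxE [X in brelu _ X]mxE [X in _ + X]mxE addr0.
rewrite mxE.
under eq_bigr => k _ do rewrite layer1 mxE -natrM.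
(* The input of the second layer counts the active conjunctions; thresholding it at 0 gives their
   disjunction. *)
rewrite -natr_sum -[X in brelu _ X](subr0) (brelu1_natB R _ 0) lt0n sum_nat_eq0.
suff -> : (c j <= v x) = ~~ [forall k, ((c j <= v (y k))%R *
    ((y k != [ffun=> false]) && [forall i, (y k i <= x i)%N]) == 0)%N].
  by case: (~~ _); rewrite ?mulr1 ?mulr0.
rewrite negb_forall; apply/idP/existsP => [cx|[k]].
  (* The bundle [x] is its own witness, nonempty because [v x >= c j > 0]. *)
  exists (enum_rank x); rewrite /y enum_rankK cx mul1n eqb0 negbK.
  apply/andP; split; last by apply/forallP.
  by apply/eqP => x0; move: cx; rewrite x0 v0 leNgt cj_gt0.
rewrite muln_eq0 !eqb0 negb_or !negbK => /and3P[ck _ /forallP yx].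
exact: le_trans ck (v_mono _ _ yx).
Qed.

Theorem theorem1 (R : realType) (m : nat) (hm : (0 < m)%N) :
  Vmon R m = MVNN R m 1.
Proof.
by apply/seteqP; split; [exact: Vmon_sub_MVNN|exact: MVNN_sub_Vmon].
Qed.
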